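(* Let $\mathrm{lrmax}(\pi)$ and $\mathrm{rlmax}(\pi)$ be the numbers of left-to-right maxima and right-to-left maxima of a permutation $\pi$, and let $UD_m$ (resp. $DU_m$) be the set of up-down (resp. down-up) permutations of $\{1,\dots,m\}$. Define $$G^{(1)}(t,p,q)=1+\sum_{n\ge1}\sum_{\pi\in UD_{2n}}p^{\mathrm{lrmax}(\pi)}q^{\mathrm{rlmax}(\pi)}\frac{t^{2n}}{(2n)!},\qquad G^{(2)}(t,p,q)=\sum_{n\ge1}\sum_{\pi\in UD_{2n-1}}p^{\mathrm{lrmax}(\pi)}q^{\mathrm{rlmax}(\pi)}\frac{t^{2n-1}}{(2n-1)!},$$ $$G^{(3)}(t,p,q)=1+\sum_{n\ge1}\sum_{\pi\in DU_{2n}}p^{\mathrm{lrmax}(\pi)}q^{\mathrm{rlmax}(\pi)}\frac{t^{2n}}{(2n)!},\qquad G^{(4)}(t,p,q)=\sum_{n\ge1}\sum_{\pi\in DU_{2n-1}}p^{\mathrm{lrmax}(\pi)}q^{\mathrm{rlmax}(\pi)}\frac{t^{2n-1}}{(2n-1)!}.$$ Then $$G^{(1)}(t,p,q)=1+\int_0^{pqt}\Big[(\sec(s/(pq)))^{p+q}\int_0^{s/q}(\sec(z/p))^{-p}dz\Big]ds,$$ $$G^{(2)}(t,p,q)=pqt+\int_0^{pqt}\Big[(\sec(s/(pq)))^{p+q}\int_0^{s/q}(\sec(z/p))^{-p}dz\int_0^{s/p}(\sec(z/q))^{-q}dz\Big]ds,$$ $$G^{(3)}(t,p,q)=1+\int_0^{pqt}\Big[(\sec(s/(pq)))^{p+q}\int_0^{s/p}(\sec(z/q))^{-q}dz\Big]ds,\qquad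 G^{(4)}(t,p,q)=\int_0^{pqt}(\sec(z/(pq)))^{p+q}dz.$$
   Context: Up-down: $\pi_1<\pi_2>\pi_3<\cdots$; down-up: $\pi_1>\pi_2<\pi_3>\cdots$. An entry is a right-to-left (resp. left-to-right) maximum if it exceeds every entry to its right (resp. left). The identities are of formal power series in $t$, with $(\sec u)^{b}=\exp(b\log\sec u)$ expanded as a power series. *)

(* Defs.v *)
From mathcomp Require Import all_boot all_order all_fingroup all_algebra.

Set Implicit Arguments.
Unset Strict Implicit.
Unset Printing Implicit Defensive.

Import GRing.Theory.
Local Open Scope ring_scope.

(* Alternating permutations of {1, ..., m} as elements of 'S_m: positions and
   values are shifted down by 1, so 1-based odd positions are even here. *)
Definition up_down m : {set 'S_m} :=
  [set s : 'S_m | [forall i : 'I_m, forall j : 'I_m, (j == i.+1 :> nat) ==>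
     (if odd i then s j < s i else s i < s j)%N]].

Definition down_up m : {set 'S_m} :=
  [set s : 'S_m | [forall i : 'I_m, forall j : 'I_m, (j == i.+1 :> nat) ==>
     (if odd i then s i < s j else s j < s i)%N]].

Definition lrmax m (s : 'S_m) : nat :=
  #|[set i : 'I_m | [forall j : 'I_m, (j < i)%N ==> (s j < s i)%N]]|.

Definition rlmax m (s : 'S_m) : nat :=
  #|[set i : 'I_m | [forall j : 'I_m, (i < j)%N ==> (s j < s i)%N]]|.

(* A formal power series is its sequence of coefficients.  Sums and scalar
   multiples are the pointwise F \+ G, F \- G and c \*o F. *)
Definition fps (K : Type) := nat -> K.

Section FPS.
Variable K : fieldType.
Implicit Types (F G : fps K) (b c : K).

Definition fps1 : fps K := fun n => (n == 0)%:R.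
Definition fpsX : fps K := fun n => (n == 1)%:R.

Definition fps_mul F G : fps K := fun n => \sum_(k < n.+1) F k * G (n - k)%N.

Definition fps_expn F n : fps K := iter n (fps_mul F) fps1.

(* F(G): meaningful only when G 0 = 0, since the terms F k * G ^ k with k > n
   are dropped from the coefficient of degree n. *)
Definition fps_comp F G : fps K := fun n => \sum_(k < n.+1) F k * fps_expn G k n.

Definition fps_prim F : fps K := fun n => if n is m.+1 then F m / n%:R else 0.

(* The integral of F between 0 and the series G, where G 0 = 0. *)
Definition fps_int F G : fps K := fps_comp (fps_prim F) G.

Definition fps_cos : fps K :=
  fun n => if odd n then 0 else (- 1) ^+ n./2 / (n`!)%:R.

(* 1 / cos, as the geometric series in 1 - cos; see fps_mul_cos_sec. *)
Definition fps_sec : fps K := fps_comp (fun=> 1) (fps1 \- fps_cos).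

(* exp F, where F 0 = 0. *)
Definition fps_exp F : fps K := fps_comp (fun n => (n`!)%:R^-1) F.

(* log F, where F 0 = 1. *)
Definition fps_log F : fps K :=
  fps_comp (fun n => if n is m.+1 then (- 1) ^+ m / n%:R else 0) (F \- fps1).

(* F ^ b, where F 0 = 1. *)
Definition fps_pow F b : fps K := fps_exp (b \*o fps_log F).

Lemma fps_expn_small F k n : F 0 = 0 -> (n < k)%N -> fps_expn F k n = 0.
Proof.
move=> F0; elim: k n => // k IHk n lt_nk.
rewrite /fps_expn iterS -/(fps_expn F k) /fps_mul big1 // => [[[|i] lt_in]] _ /=.
  by rewrite F0 mul0r.
rewrite IHk ?mulr0 //; apply: leq_trans (_ : n <= k)%N => //.
by rewrite ltn_subrL (leq_trans _ (lt_in : i.+1 <= n)%N).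
Qed.

Lemma fps_mul_cos_sec : fps_mul fps_cos fps_sec =1 fps1.
Proof.
set H := fps1 \- fps_cos => n.
have H0 : H 0 = 0 by rewrite /H /= /fps_cos /fps1 /= expr0 fact0 divr1 subrr.
transitivity (\sum_(i < n.+1) \sum_(k < n.+1)
    fps_cos i * fps_expn H k (n - i)%N).
  apply: eq_bigr => i _; rewrite -[RHS]mulr_sumr; congr (_ * _).
  rewrite /fps_sec /fps_comp -/H.
  rewrite (big_ord_widen n.+1 (fun k => 1 * fps_expn H k (n - i)%N));
    last by rewrite ltnS leq_subr.
  rewrite big_mkcond /=; apply: eq_bigr => k _; rewrite mul1r.
  by case: ltnP => // lt_ik; rewrite fps_expn_small.
rewrite exchange_big /=.
transitivity (\sum_(k < n.+1) (fps_expn H k n - fps_expn H k.+1 n)).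
  apply: eq_bigr => k _; rewrite -[fps_expn H k.+1 n]/(fps_mul H (fps_expn H k) n).
  rewrite /fps_mul; have -> : fps_expn H k n = \sum_(i < n.+1) fps1 i * fps_expn H k (n - i)%N.
    by rewrite big_ord_recl big1 ?addr0 /fps1 /= ?mul1r ?subn0 // => i _;
      rewrite /= mul0r.
  rewrite -sumrB; apply: eq_bigr => i _; rewrite -mulrBl /H /=.
  by rewrite opprB addrC subrK.
rewrite -(big_mkord xpredT (fun k => fps_expn H k n - fps_expn H k.+1 n)).
under eq_bigr do rewrite -opprB.
by rewrite sumrN telescope_sumr // opprB (@fps_expn_small H n.+1) ?subr0.
Qed.

(* The sum over the m >= 1 with odd m = b and over the s in A m of
   p ^ lrmax s * q ^ rlmax s * t ^ m / m! *)
Definition max_gf (A : forall m, {set 'S_m}) (b : bool) (p q : K) : fps K :=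
  fun m => if (0 < m)%N && (odd m == b)
           then (\sum_(s in A m) p ^+ lrmax s * q ^+ rlmax s) / (m`!)%:R
           else 0.

Definition G1 (p q : K) : fps K := fps1 \+ max_gf up_down false p q.
Definition G2 (p q : K) : fps K := max_gf up_down true p q.
Definition G3 (p q : K) : fps K := fps1 \+ max_gf down_up false p q.
Definition G4 (p q : K) : fps K := max_gf down_up true p q.

(* sec(c * x) ^ b as a power series in x *)
Definition sec_pow c b : fps K := fps_pow (fps_comp fps_sec (c \*o fpsX)) b.

End FPS.

Arguments fps1 {K}.
Arguments fpsX {K}.
Arguments fps_cos {K}.
Arguments fps_sec {K}.

(* Main.v *)
(* Cut an alternating permutation at its maximum: the left factor carries the other
   left-to-right maxima, the right factor the other right-to-left maxima; the last
   step of the left factor goes down and the first step of the right factor goes up.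
   After reversing the right factor, both factors are
   counted by E_x and O_x, the series by left-to-right maxima of the alternating
   permutations of even, resp. odd, length whose last step goes down.  So each
   t-derivative is p q times a product of one series in p and one in q (plus the
   term p q coming from the permutation of length 1 in the case of G2).  At q = 1 this
   is the system O_1' = 1 + O_1^2, E_x' = x O_1 E_x, O_x' = x (1 + O_1 O_x).  Hence
   E_x E_y = E_(x+y); moreover E_(-1)'' = - E_(-1), so that E_(-1) = cos, E_x = sec^x
   and O_x = x E_x (int E_(-x)). *)

Require Import Defs.
From mathcomp Require Import all_boot all_order all_fingroup all_algebra ring.
From Stdlib Require Import FunctionalExtensionality.

Set Implicit Arguments.
Unset Strict Implicit.
Unset Printing Implicit Defensive.

Import GRing.Theory.
Local Open Scope ring_scope.

(** * Alternation and maxima of words, a setting stable under restriction to a block of positions *)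

Definition alternating b m (f : 'I_m -> nat) : bool :=
  [forall i : 'I_m, forall j : 'I_m, (j == i.+1 :> nat) ==>
     (if odd i (+) b then f j < f i else f i < f j)%N].

Definition lrmaxima m (f : 'I_m -> nat) : nat :=
  #|[set i : 'I_m | [forall j : 'I_m, (j < i)%N ==> (f j < f i)%N]]|.

Definition rlmaxima m (f : 'I_m -> nat) : nat :=
  #|[set i : 'I_m | [forall j : 'I_m, (i < j)%N ==> (f j < f i)%N]]|.

Lemma up_downE m (s : 'S_m) : (s \in up_down m) = alternating false (fun i => s i).
Proof.
rewrite inE; apply: eq_forallb => i; apply: eq_forallb => j.
by rewrite addbF.
Qed.

Lemma down_upE m (s : 'S_m) : (s \in down_up m) = alternating true (fun i => s i).
Proof.
rewrite inE; apply: eq_forallb => i; apply: eq_forallb => j.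
by rewrite addbT; case: odd.
Qed.

Definition same_order m (f g : 'I_m -> nat) :=
  forall i j, (f i < f j)%N = (g i < g j)%N.

Lemma alternating_same_order b m (f g : 'I_m -> nat) :
  same_order f g -> alternating b f = alternating b g.
Proof.
move=> fg; apply: eq_forallb => i; apply: eq_forallb => j.
by rewrite !fg.
Qed.

Lemma lrmaxima_same_order m (f g : 'I_m -> nat) :
  same_order f g -> lrmaxima f = lrmaxima g.
Proof.
move=> fg; apply: eq_card => i; rewrite !inE; apply: eq_forallb => j.
by rewrite fg.
Qed.

Lemma rlmaxima_same_order m (f g : 'I_m -> nat) :
  same_order f g -> rlmaxima f = rlmaxima g.
Proof.
move=> fg; apply: eq_card => i; rewrite !inE; apply: eq_forallb => j.
by rewrite fg.
Qed.

(** The permutation sends a position to its rank, the number of positions that carry a smaller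
    value. *)
Lemma standardization m (f : 'I_m -> nat) :
  injective f -> exists u : 'S_m, same_order f (fun i => u i).
Proof.
move=> f_inj; pose below i := [set j | (f j < f i)%N].
have below_lt i : (#|below i| < m)%N.
  rewrite -[m in X in (_ < X)%N]card_ord; apply: proper_card.
  by apply/properP; split; [apply/subsetP | exists i; rewrite // inE ltnn].
pose r i := Ordinal (below_lt i).
have r_lt i j : (f i < f j)%N -> (r i < r j)%N.
  move=> fij; apply: proper_card; apply/properP; split.
    by apply/subsetP=> h; rewrite !inE => /ltn_trans; apply.
  by exists i; rewrite inE ?ltnn.
have r_mono : same_order f (fun i => r i).
  move=> i j; apply/idP/idP; first exact: r_lt.
  case: (ltngtP (f i) (f j)) => // [/r_lt ji /(ltn_trans ji)|/f_inj ->];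
    by rewrite ltnn.
have r_inj : injective r.
  move=> i j rij; apply: f_inj.
  by case: (ltngtP (f i) (f j)) => //; rewrite r_mono rij ltnn.
by exists (perm r_inj) => i j; rewrite !permE r_mono.
Qed.

(** * Order-invariant weights and products of exponential generating functions *)

Definition order_inv (T : Type) m (w : ('I_m -> nat) -> T) :=
  forall f g, same_order f g -> w f = w g.

(** If [r] standardizes [f], the word [f \o u] is ordered like [u * r], and right multiplication by
    [r] permutes ['S_m]. *)
Lemma sum_perm_inj (K : fieldType) m (w : ('I_m -> nat) -> K) (f : 'I_m -> nat) :
    order_inv w -> injective f ->
  \sum_(u : 'S_m) w (fun i => f (u i)) = \sum_(u : 'S_m) w (fun i => u i).
Proof.
move=> w_inv /standardization [r fr].
rewrite [RHS](reindex_inj (mulIg r)); apply: eq_bigr => u _.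
by apply: w_inv => i j; rewrite !permM fr.
Qed.

(** The embedding of ['S_k] x ['S_l] in ['S_(k + l)] as a Young subgroup. *)
Definition perm_sum_fun k l (u : 'S_k) (v : 'S_l) (i : 'I_(k + l)) : 'I_(k + l) :=
  match split i with inl a => lshift l (u a) | inr c => rshift k (v c) end.

Lemma perm_sum_fun_lshift k l (u : 'S_k) (v : 'S_l) i :
  perm_sum_fun u v (lshift l i) = lshift l (u i).
Proof. by rewrite /perm_sum_fun (unsplitK (inl i)). Qed.

Lemma perm_sum_fun_rshift k l (u : 'S_k) (v : 'S_l) i :
  perm_sum_fun u v (rshift k i) = rshift k (v i).
Proof. by rewrite /perm_sum_fun (unsplitK (inr i)). Qed.

Lemma perm_sum_fun_inj k l (u : 'S_k) (v : 'S_l) : injective (perm_sum_fun u v).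
Proof.
apply: (can_inj (g := perm_sum_fun u^-1%g v^-1%g)) => i.
by case: (split_ordP i) => a ->;
  rewrite ?perm_sum_fun_lshift ?perm_sum_fun_rshift permK.
Qed.

Definition perm_sum k l (u : 'S_k) (v : 'S_l) : 'S_(k + l) :=
  perm (@perm_sum_fun_inj k l u v).

Lemma perm_sum_lshift k l (u : 'S_k) (v : 'S_l) i :
  perm_sum u v (lshift l i) = lshift l (u i).
Proof. by rewrite permE perm_sum_fun_lshift. Qed.

Lemma perm_sum_rshift k l (u : 'S_k) (v : 'S_l) i :
  perm_sum u v (rshift k i) = rshift k (v i).
Proof. by rewrite permE perm_sum_fun_rshift. Qed.

Definition egf_coef (K : fieldType) m (w : ('I_m -> nat) -> K) : K :=
  (\sum_(u : 'S_m) w (fun i => u i)) / (m`!)%:R.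

(* Summing over the positions moved by 'S_k x 'S_l makes both factors
   independent of the permutation. *)
Lemma egf_coefM (K : fieldType) k l (v : ('I_k -> nat) -> K) (w : ('I_l -> nat) -> K) :
    [pchar K] =i pred0 -> order_inv v -> order_inv w ->
  egf_coef (fun f : 'I_(k + l) -> nat => v (f \o @lshift k l) * w (f \o @rshift k l))
  = egf_coef v * egf_coef w.
Proof.
move=> charK v_inv w_inv.
have fact_neq0 n : (n`!)%:R != 0 :> K.
  by move/pcharf0P: charK => ->; rewrite -lt0n fact_gt0.
set S := (X in egf_coef X).
have invS : order_inv S.
  by move=> f g fg; congr (_ * _); [apply: v_inv | apply: w_inv] => i j /=; rewrite fg.
have avg : (k`! * l`!)%:R * (\sum_(t : 'S_(k + l)) S (fun i => t i)) =
    ((k + l)`!)%:R * ((\sum_(u : 'S_k) v (fun i => u i)) * \sum_(u : 'S_l) w (fun i => u i)).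
  transitivity (\sum_(u : 'S_k) \sum_(u' : 'S_l) \sum_(t : 'S_(k + l)) S (fun i => t i)).
    rewrite !sumr_const !card_Sn -mulrnA mulrC mulr_natr mulnC.
    by rewrite mulnC.
  transitivity (\sum_(t : 'S_(k + l)) (\sum_(u : 'S_k) v (fun i => u i)) *
      \sum_(u : 'S_l) w (fun i => u i)); last first.
    by rewrite sumr_const card_Sn mulr_natl.
  transitivity (\sum_(u : 'S_k) \sum_(u' : 'S_l) \sum_(t : 'S_(k + l))
      v (fun i => t (lshift l (u i))) * w (fun i => t (rshift k (u' i)))).
    apply: eq_bigr => u _; apply: eq_bigr => u' _.
    rewrite (reindex_inj (mulgI (perm_sum u u'))); apply: eq_bigr => t _.
    congr (_ * _); [apply: v_inv | apply: w_inv] => i j /=;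
      by rewrite !permM ?perm_sum_lshift ?perm_sum_rshift.
  under eq_bigr do rewrite exchange_big.
  rewrite exchange_big; apply: eq_bigr => t _.
  (* For fixed [t], the words on the two blocks are injective, so only their standardizations matter
     and [t] disappears. *)
  rewrite -(sum_perm_inj (f := fun i => t (lshift l i)) v_inv); last first.
    by move=> i j /val_inj/perm_inj/lshift_inj.
  rewrite -(sum_perm_inj (f := fun i => t (rshift k i)) w_inv); last first.
    by move=> i j /val_inj/perm_inj/rshift_inj.
  by rewrite big_distrlr.
rewrite /egf_coef; set A := \sum_(u : 'S_k) _ in avg *; set B := \sum_(u : 'S_l) _ in avg *.
move: avg; set C := \sum_(t : 'S_(k + l)) _; rewrite natrM => avg.
have -> : C = (k + l)`!%:R * (A * B) / (k`!%:R * l`!%:R).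
  by rewrite -avg mulrC mulKf // mulf_neq0.
by field; rewrite !fact_neq0.
Qed.

(** * Words cut at the position of their maximum *)

Lemma alternatingP b m (f : 'I_m -> nat) :
  reflect (forall i j : 'I_m, j = i.+1 :> nat ->
             if odd i (+) b then (f j < f i)%N else (f i < f j)%N)
          (alternating b f).
Proof.
apply: (iffP forallP) => [alt i j ji | alt i].
  by have /forallP/(_ j)/implyP := alt i; rewrite ji eqxx => /(_ isT); case: ifP.
by apply/forallP=> j; apply/implyP=> /eqP /alt; case: ifP.
Qed.

Section MaxDecomposition.

Variables (k l : nat) (h : 'I_(k + l).+1) (f : 'I_(k + l).+1 -> nat).
Hypotheses (hk : h = k :> nat) (f_max : forall i, (f (lift h i) < f h)%N).

Let before (a : 'I_k) := lift h (lshift l a).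
Let after (c : 'I_l) := lift h (rshift k c).

Let bump_before (a : 'I_k) : bump h a = a.
Proof. by rewrite /bump hk leqNgt ltn_ord. Qed.

Let bump_after (c : 'I_l) : bump h (k + c) = (k + c).+1.
Proof. by rewrite /bump hk leq_addr. Qed.

Let val_before a : before a = a :> nat := bump_before a.

Let val_after c : after c = (k + c).+1 :> nat := bump_after c.

Let ord_ind (P : 'I_(k + l).+1 -> Prop) :
  P h -> (forall a, P (before a)) -> (forall c, P (after c)) -> forall i, P i.
Proof.
move=> Ph Pb Pa i; case: (unliftP h i) => [j|] -> //.
by case: (split_ordP j) => a ->; [exact: Pb | exact: Pa].
Qed.

(** The position [h] counts once, it disqualifies every later position, and an earlier position is
    only compared with positions before it. *)
Lemma lrmaxima_max : lrmaxima f = (lrmaxima (f \o before)).+1.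
Proof.
rewrite /lrmaxima -!sum1dep_card (bigD1_ord h) /=; last first.
  apply/forallP=> j; apply/implyP; case: (unliftP h j) => [i|] ->; last by rewrite ltnn.
  by rewrite f_max.
rewrite big_split_ord /= add1n; congr _.+1; rewrite [X in (_ + X)%N]big_pred0 ?addn0.
  apply: eq_bigl => a; apply/forallP/forallP=> lra j.
    have : (before j < before a)%N ==> (f (before j) < f (before a))%N := lra (before j).
    by rewrite !val_before.
  rewrite bump_before; elim/ord_ind: j => [|j|c].
  - by rewrite hk ltnNge ltnW.
  - by rewrite val_before; apply: lra.
  by rewrite val_after ltnNge ltnW // ltnS ltnW // ltn_addr.
move=> c; rewrite bump_after; apply/negbTE/negP=> /forallP/(_ h).
by rewrite hk ltnS leq_addr ltnNge ltnW ?f_max.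
Qed.

Lemma rlmaxima_max : rlmaxima f = (rlmaxima (f \o after)).+1.
Proof.
rewrite /rlmaxima -!sum1dep_card (bigD1_ord h) /=; last first.
  apply/forallP=> j; apply/implyP; case: (unliftP h j) => [i|] ->; last by rewrite ltnn.
  by rewrite f_max.
rewrite big_split_ord /= add1n; congr _.+1; rewrite [X in (X + _)%N]big_pred0 ?add0n.
  apply: eq_bigl => a; apply/forallP/forallP=> rla j.
    have : (after a < after j)%N ==> (f (after j) < f (after a))%N := rla (after j).
    by rewrite !val_after ltnS ltn_add2l.
  rewrite bump_after; elim/ord_ind: j => [|j|c].
  - by rewrite hk ltnNge ltnW // ltnS leq_addr.
  - by rewrite val_before ltnNge ltnW // ltnS ltnW // ltn_addr.
  by rewrite val_after ltnS ltn_add2l; apply: rla.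
move=> c; rewrite bump_before; apply/negbTE/negP=> /forallP/(_ h).
by rewrite hk ltn_ord ltnNge ltnW ?f_max.
Qed.

(** If the maximum has a neighbour it must sit on a peak, and position [k] is a peak when
    [odd k (+) b]. The right factor starts at position [k.+1], which shifts parities by
    [~~ odd k]. *)
Lemma alternating_max b :
  alternating b f = [&& (0 < k + l)%N ==> (odd k (+) b),
                        alternating b (f \o before)
                      & alternating (b (+) ~~ odd k) (f \o after)].
Proof.
apply/alternatingP/and3P => [alt | [/implyP top /alternatingP altL /alternatingP altR]].
  split.
  - apply/implyP; case: (posnP k) => [k0 | k_gt0].
      rewrite {1}k0 => l_gt0.
      have := alt h (after (Ordinal l_gt0)); rewrite hk val_after /= addn0 => /(_ erefl).
      by case: (odd k (+) b) => //; rewrite ltnNge ltnW ?f_max.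
    move=> _; have ltk : (k.-1 < k)%N by rewrite prednK.
    have := alt (before (Ordinal ltk)) h; rewrite hk val_before /= prednK // => /(_ erefl).
    rewrite -[in odd k](prednK k_gt0) /=.
    by case: (odd _); case: b {alt} => //=; rewrite ltnNge ltnW ?f_max.
  - apply/alternatingP => i j ji; have := alt (before i) (before j).
    by rewrite !val_before => /(_ ji).
  - apply/alternatingP => i j ji; have := alt (after i) (after j).
    rewrite !val_after ji addnS /= oddD => /(_ erefl).
    by case: (odd k); case: (odd i); case: b {alt}.
elim/ord_ind => [|a|c]; elim/ord_ind => [|a'|c'];
  rewrite ?hk ?val_before ?val_after.
- by move/n_Sn.
- by move=> e; have := ltn_ord a'; rewrite ltnNge e leqnSn.
- by case=> e; rewrite top ?f_max // addn_gt0 orbC (leq_trans _ (ltn_ord c')).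
- move=> /(congr1 odd) /= ek; have k_gt0 := leq_ltn_trans (leq0n a) (ltn_ord a).
  have := top (ltn_addr l k_gt0); rewrite ek f_max.
  by case: (odd a); case: b {top altL altR}.
- exact: altL.
- by move=> [e]; have := ltn_ord a; rewrite -e ltnNge leq_addr.
- by move=> e; have : (k < (k + c).+2)%N; [rewrite ltnS ltnW // ltnS leq_addr | rewrite -e ltnn].
- by move=> e; have := ltn_ord a'; rewrite ltnNge e ltnW // ltnS ltnW // ltnS leq_addr.
case; rewrite -addnS => /addnI /altR.
by rewrite addnS /= oddD; case: (odd k); case: (odd c); case: b {top altL altR}.
Qed.

End MaxDecomposition.

(** * Insertion of the maximum, and reversal of positions *)

Lemma sum_lift_perm (V : nmodType) n (w : 'S_n.+1 -> V) :
  \sum_s w s = \sum_(h < n.+1) \sum_(t : 'S_n) w (lift_perm h ord_max t).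
Proof.
rewrite pair_big /=.
(* [h] is the position of the largest value. Injectivity is enough, as both sides have (n+1)!
   elements. *)
pose F (ht : 'I_n.+1 * 'S_n) := lift_perm ht.1 ord_max ht.2.
rewrite (reindex F) //=; apply: onW_bij; apply: inj_card_bij; last first.
  by rewrite card_prod card_ord !card_Sn factS.
move=> [h t] [h' t']; rewrite /F /= => eqF.
have eqh : h = h'.
  apply: (@perm_inj _ (lift_perm h ord_max t)).
  by rewrite lift_perm_id eqF lift_perm_id.
rewrite -eqh in eqF *; congr (_, _); apply/permP=> i.
by apply: (@lift_inj _ ord_max); rewrite -!(lift_perm_lift h) eqF.
Qed.

(** Reversal exchanges ascents and descents, and sends the step at [i] to the step at m - 2 - i,
    which has the parity of m + i. *)
Lemma alternating_rev b m (f : 'I_m -> nat) :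
  alternating b (f \o @rev_ord m) = alternating (b (+) ~~ odd m) f.
Proof.
have dir c (g : 'I_m -> nat) : alternating (c (+) ~~ odd m) g ->
    alternating c (g \o @rev_ord m).
  move/alternatingP=> alt; apply/alternatingP=> i j ji /=.
  have lt_im : (i.+1 < m)%N by rewrite -ji.
  have := alt (rev_ord j) (rev_ord i); rewrite /= ji subnSK // => /(_ erefl).
  rewrite oddB //=.
  by case: (odd m); case: (odd i); case: c {alt}.
apply/idP/idP => [alt|]; last exact: dir.
(* The converse is [dir] for the reversed word: both reversal and the change of [b] are
   involutions. *)
have := dir (b (+) ~~ odd m) (f \o @rev_ord m).
rewrite -addbA addbb addbF => /(_ alt) /alternatingP alt'.
by apply/alternatingP=> i j /alt' /=; rewrite !rev_ordK.
Qed.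

Lemma rlmaxima_rev m (f : 'I_m -> nat) : rlmaxima (f \o @rev_ord m) = lrmaxima f.
Proof.
rewrite /rlmaxima /lrmaxima -!sum1dep_card [RHS](reindex_inj rev_ord_inj) /=.
have rev_lt (i j : 'I_m) : (i < rev_ord j)%N = (j < rev_ord i)%N.
  by rewrite /= !ltn_subRL !addSn addnC.
apply: eq_bigl => i; apply/forallP/forallP => mx j; have := mx (rev_ord j).
  by rewrite rev_lt /comp rev_ordK.
by rewrite -rev_lt rev_ordK.
Qed.

(** * Recurrence for the weighted count of alternating permutations *)

Section MaximaSeries.

Variable K : fieldType.
Hypothesis charK : [pchar K] =i pred0.
Implicit Types (x y p q : K).

Definition max_weight b x y m (f : 'I_m -> nat) : K :=
  (alternating b f)%:R * (x ^+ lrmaxima f * y ^+ rlmaxima f).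

Lemma max_weight_order b x y m : order_inv (@max_weight b x y m).
Proof.
move=> f g fg; rewrite /max_weight (alternating_same_order _ fg).
by rewrite (lrmaxima_same_order fg) (rlmaxima_same_order fg).
Qed.

Definition max_egf b x y m : K := egf_coef (@max_weight b x y m).

Lemma max_egf0 b x y : max_egf b x y 0 = 1.
Proof.
rewrite /max_egf /egf_coef fact0 divr1.
rewrite (eq_bigr (fun=> 1)) ?sumr_const ?card_Sn // => s _; rewrite /max_weight.
rewrite (_ : alternating _ _ = true); last by apply/alternatingP => -[].
by rewrite /lrmaxima /rlmaxima !eq_card0 ?expr0 ?mulr1 // => -[].
Qed.

(** This turns right factors, weighted by right-to-left maxima, into series by left-to-right
    maxima. *)
Lemma max_egf_rev b y m : max_egf b 1 y m = max_egf (b (+) ~~ odd m) y 1 m.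
Proof.
congr (_ / _); rewrite [LHS](reindex_inj (mulgI (perm (@rev_ord_inj m)))).
apply: eq_bigr => s _.
transitivity (max_weight b 1 y ((fun i => s i : nat) \o @rev_ord m)).
  by apply: max_weight_order => i j; rewrite !permM !permE.
by rewrite /max_weight alternating_rev rlmaxima_rev !expr1n mul1r mulr1.
Qed.

(** The factor [x * y] is the contribution of the maximum itself, which is a maximum from both
    sides. *)
Lemma max_weight_max b x y k l (h : 'I_(k + l).+1) (t : 'S_(k + l)) :
    h = k :> nat ->
  max_weight b x y (fun i => lift_perm h ord_max t i) =
  ((0 < k + l)%N ==> (odd k (+) b))%:R * (x * y) *
  (max_weight b x 1 ((fun i => t i : nat) \o @lshift k l) *
   max_weight (b (+) ~~ odd k) 1 y ((fun i => t i : nat) \o @rshift k l)).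
Proof.
move=> hk; set f := fun i => _ : nat.
have fE i : f (lift h i) = t i by rewrite /f lift_perm_lift lift_max.
have f_max i : (f (lift h i) < f h)%N.
  by rewrite fE /f lift_perm_id /= ltn_ord.
have fL : same_order (fun a => f (lift h (lshift l a))) ((fun i => t i : nat) \o @lshift k l).
  by move=> i j; rewrite !fE.
have fR : same_order (fun c => f (lift h (rshift k c))) ((fun i => t i : nat) \o @rshift k l).
  by move=> i j; rewrite !fE.
rewrite -(max_weight_order _ _ _ fL) -(max_weight_order _ _ _ fR) /max_weight.
rewrite (alternating_max hk) // (lrmaxima_max hk) // (rlmaxima_max hk) //.
by rewrite -!mulnb !natrM !exprS !expr1n; ring.
Qed.

(** Here [k] is the position of the maximum; the guard [0 < n] exempts the word of length 1, where
    the maximum has no neighbour. *)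
Lemma max_egf_rec b x y n :
  n.+1%:R * max_egf b x y n.+1 =
  x * y * \sum_(k < n.+1) ((0 < n)%N ==> (odd k (+) b))%:R *
    (max_egf b x 1 k * max_egf (b (+) ~~ odd k) 1 y (n - k)).
Proof.
have nat_neq0 m : m.+1%:R != 0 :> K by move/pcharf0P: charK => ->.
have fact_neq0 m : (m`!)%:R != 0 :> K.
  by move/pcharf0P: charK => ->; rewrite -lt0n fact_gt0.
rewrite {1}/max_egf /egf_coef factS natrM sum_lift_perm.
rewrite mulrCA invfM mulVKf // mulr_suml mulr_sumr; apply: eq_bigr => h _.
(* The length is generalized to [m] so that it can be replaced by [k + l], the form in which the
   word splits into blocks; [n] is not convertible to [k + (n - k)]. *)
have aux k l m (h' : 'I_m.+1) : (k + l)%N = m -> h' = k :> nat ->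
    (\sum_(t : 'S_m) max_weight b x y (fun i => lift_perm h' ord_max t i)) / (m`!)%:R =
    x * y * (((0 < m)%N ==> (odd k (+) b))%:R *
      (max_egf b x 1 k * max_egf (b (+) ~~ odd k) 1 y l)).
  move=> klm; case: m / klm h' => h' hk.
  rewrite -egf_coefM //; try exact: max_weight_order.
  under eq_bigr do rewrite max_weight_max //.
  by rewrite -mulr_sumr /egf_coef; ring.
by apply: aux => //; rewrite subnKC // -ltnS.
Qed.

End MaximaSeries.

(** * Calculus of formal power series in characteristic zero *)

Section PowerSeries.

Variable K : fieldType.
Hypothesis charK : [pchar K] =i pred0.
Implicit Types (F G H : fps K) (a b c : K).

Lemma natS_neq0 n : n.+1%:R != 0 :> K.
Proof. by move/pcharf0P: charK => ->. Qed.

Definition deriv F : fps K := fun n => n.+1%:R * F n.+1.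

Definition scale_var c F : fps K := fun n => c ^+ n * F n.

(** Truncation to polynomials lets the ring laws of [{poly K}] pass to series. *)
Lemma fps_mul_poly F G m n : (n <= m)%N ->
  fps_mul F G n = ((\poly_(i < m.+1) F i) * (\poly_(i < m.+1) G i))`_n.
Proof.
move=> le_nm; rewrite coefM; apply: eq_bigr => i _; rewrite !coef_poly.
by rewrite !ifT // ltnS (leq_trans _ le_nm) // ?leq_subr // -ltnS.
Qed.

Lemma fps_mulC F G : fps_mul F G = fps_mul G F.
Proof.
by apply: functional_extensionality => n; rewrite !(@fps_mul_poly _ _ n) // mulrC.
Qed.

Lemma fps_mulA F G H : fps_mul F (fps_mul G H) = fps_mul (fps_mul F G) H.
Proof.
apply: functional_extensionality => n.
pose t L := \poly_(i < n.+1) (L i : K).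
have tE L i : (i <= n)%N -> (t L)`_i = L i by move=> le_in; rewrite coef_poly ltnS le_in.
transitivity ((t F * (t G * t H))`_n).
  rewrite coefM; apply: eq_bigr => i _; rewrite tE; last by rewrite -ltnS.
  by congr (_ * _); apply: fps_mul_poly; apply: leq_subr.
rewrite mulrA coefM; apply: eq_bigr => i _; rewrite tE ?leq_subr //.
by congr (_ * _); rewrite -fps_mul_poly // -ltnS.
Qed.

Lemma fps_mul1 F : fps_mul fps1 F = F.
Proof.
apply: functional_extensionality => n; rewrite /fps_mul big_ord_recl big1 ?addr0.
  by rewrite /fps1 mul1r subn0.
by move=> i _; rewrite /fps1 mul0r.
Qed.

Lemma fps_mulr1 F : fps_mul F fps1 = F.
Proof. by rewrite fps_mulC fps_mul1. Qed.

Lemma fps_mulDl F G H : fps_mul (F \+ G) H = fps_mul F H \+ fps_mul G H.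
Proof.
apply: functional_extensionality => n; rewrite /= /fps_mul -big_split.
by apply: eq_bigr => i _; rewrite mulrDl.
Qed.

Lemma fps_mulAC F G H : fps_mul (fps_mul F G) H = fps_mul (fps_mul F H) G.
Proof. by rewrite -!fps_mulA (fps_mulC G). Qed.

Lemma fps_mulZl a F G : fps_mul (a \*o F) G = a \*o fps_mul F G.
Proof.
apply: functional_extensionality => n; rewrite /fps_mul /= mulr_sumr.
by apply: eq_bigr => i _; rewrite mulrA.
Qed.

Lemma fps_mulZr a F G : fps_mul F (a \*o G) = a \*o fps_mul F G.
Proof. by rewrite fps_mulC fps_mulZl fps_mulC. Qed.

Lemma fps_mulDr F G H : fps_mul F (G \+ H) = fps_mul F G \+ fps_mul F H.
Proof. by rewrite !(fps_mulC F) fps_mulDl. Qed.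

Lemma fps_mul_0 F G : fps_mul F G 0 = F 0 * G 0.
Proof. by rewrite /fps_mul big_ord1. Qed.

(** The coefficient of degree [n] of the product is [G n] plus terms in lower coefficients of
    [G]. *)
Lemma fps_mul_lreg F G H : F 0 = 1 -> fps_mul F G = fps_mul F H -> G = H.
Proof.
move=> F0 eqFGH; apply: functional_extensionality => n.
elim/ltn_ind: n => n IHn; have := congr1 (fun L => L n) eqFGH.
rewrite /fps_mul !big_ord_recl /= F0 !mul1r subn0.
rewrite [in RHS](eq_bigr (fun i : 'I_n => F (bump 0 i) * G (n - bump 0 i)%N)).
  by move/addIr.
by move=> i _; rewrite IHn // /bump /= ltn_subrL (leq_ltn_trans _ (ltn_ord i)).
Qed.

Lemma derivD F G : deriv (F \+ G) = deriv F \+ deriv G.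
Proof. by apply: functional_extensionality => n; rewrite /deriv /= mulrDr. Qed.

Lemma derivZ a F : deriv (a \*o F) = a \*o deriv F.
Proof. by apply: functional_extensionality => n; rewrite /deriv /= mulrCA. Qed.

Lemma deriv_fps1 : deriv fps1 = 0 \*o fps1.
Proof.
by apply: functional_extensionality => n; rewrite /deriv /fps1 /= mulr0 mul0r.
Qed.

Lemma deriv_prim F : deriv (fps_prim F) = F.
Proof.
apply: functional_extensionality => n; rewrite /deriv /=.
by rewrite mulrC divfK ?natS_neq0.
Qed.

Lemma deriv_scale c F : deriv (scale_var c F) = c \*o scale_var c (deriv F).
Proof.
by apply: functional_extensionality => n; rewrite /deriv /scale_var /= exprS; ring.
Qed.

Lemma scale_mul c F G :
  scale_var c (fps_mul F G) = fps_mul (scale_var c F) (scale_var c G).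
Proof.
apply: functional_extensionality => n; rewrite /scale_var /fps_mul mulr_sumr.
apply: eq_bigr => i _.
have -> : c ^+ n = c ^+ i * c ^+ (n - i) by rewrite -exprD subnKC // -ltnS.
by ring.
Qed.

Lemma derivM F G :
  deriv (fps_mul F G) = fps_mul (deriv F) G \+ fps_mul F (deriv G).
Proof.
apply: functional_extensionality => n; rewrite /deriv /fps_mul /= mulr_sumr.
(* The factor n + 1 is split as i + (n + 1 - i), one summand for each factor differentiated; each
   half loses one extreme term. *)
rewrite (eq_bigr (fun i : 'I_n.+2 => i%:R * F i * G (n.+1 - i)%N +
   F i * ((n.+1 - i)%:R * G (n.+1 - i)%N))); last first.
  move=> i _.
  have -> : n.+1%:R = i%:R + (n.+1 - i)%:R :> K by rewrite -natrD subnKC // -ltnS.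
  by ring.
rewrite big_split /=; congr (_ + _).
  by rewrite big_ord_recl mul0r mul0r add0r; apply: eq_bigr => i _.
rewrite big_ord_recr /= subnn mul0r mulr0 addr0; apply: eq_bigr => i _.
by rewrite subSn // -ltnS.
Qed.

Lemma deriv_inj F G : F 0 = G 0 -> deriv F = deriv G -> F = G.
Proof.
move=> FG0 dFG; apply: functional_extensionality => -[//|n].
apply: (mulfI (natS_neq0 n)); exact: (congr1 (fun L => L n) dFG).
Qed.

(** The equation gives (n + 1) F(n + 1) from the coefficients of degree at most n, and n + 1 is
    invertible. *)
Lemma linear_ode_unique A B F G : F 0 = G 0 ->
  deriv F = B \+ fps_mul A F -> deriv G = B \+ fps_mul A G -> F = G.
Proof.
move=> FG0 dF dG; apply: functional_extensionality => n.
elim/ltn_ind: n => -[//|n] IHn; apply: (mulfI (natS_neq0 n)).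
rewrite -/(deriv F n) -/(deriv G n) dF dG /=; congr (_ + _).
by apply: eq_bigr => i _; rewrite IHn // ltnS leq_subr.
Qed.

Lemma deriv_expn F k :
  deriv (fps_expn F k.+1) = k.+1%:R \*o fps_mul (fps_expn F k) (deriv F).
Proof.
elim: k => [|k IHk].
  rewrite /fps_expn /= fps_mulr1 fps_mul1.
  by apply: functional_extensionality => n /=; rewrite mul1r.
rewrite /fps_expn iterS -/(fps_expn F k.+1) derivM IHk fps_mulZr fps_mulA.
rewrite -[fps_mul F (fps_expn F k)]/(fps_expn F k.+1) [fps_mul (deriv F) _]fps_mulC.
by apply: functional_extensionality => n /=; rewrite [in RHS]mulrSr; ring.
Qed.

Lemma fps_comp_widen F G m n : G 0 = 0 -> (n <= m)%N ->
  fps_comp F G n = \sum_(k < m.+1) F k * fps_expn G k n.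
Proof.
move=> G0 le_nm; rewrite /fps_comp.
rewrite (big_ord_widen m.+1 (fun k => F k * fps_expn G k n)) // big_mkcond /=.
apply: eq_bigr => k _; case: ltnP => // lt_nk.
by rewrite fps_expn_small ?mulr0.
Qed.

Lemma fps_comp_0 F G : fps_comp F G 0 = F 0.
Proof. by rewrite /fps_comp big_ord1 /fps_expn /= /fps1 mulr1. Qed.

(** Widening all inner sums to the same range [k <= n] allows the exchange of summations. *)
Lemma fps_mul_compl F G H n : G 0 = 0 ->
  fps_mul (fps_comp F G) H n = \sum_(k < n.+1) F k * fps_mul (fps_expn G k) H n.
Proof.
move=> G0; rewrite /fps_mul.
under [RHS]eq_bigr do rewrite mulr_sumr.
rewrite [RHS]exchange_big /=; apply: eq_bigr => i _.
rewrite (@fps_comp_widen _ _ n) // -1?ltnS // mulr_suml.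
by apply: eq_bigr => k _; rewrite mulrA.
Qed.

Lemma deriv_comp F G : G 0 = 0 ->
  deriv (fps_comp F G) = fps_mul (fps_comp (deriv F) G) (deriv G).
Proof.
move=> G0; apply: functional_extensionality => n.
rewrite fps_mul_compl // {1}/deriv /fps_comp big_ord_recl.
(* The term of index 0 is constant: [fps1] has no coefficient in degree [n.+1]. *)
rewrite (_ : F _ * _ = 0); last exact: mulr0.
rewrite add0r mulr_sumr; apply: eq_bigr => k _.
have eG : n.+1%:R * fps_expn G k.+1 n.+1 = k.+1%:R * fps_mul (fps_expn G k) (deriv G) n.
  by rewrite -[LHS]/(deriv (fps_expn G k.+1) n) deriv_expn.
transitivity (F k.+1 * (n.+1%:R * fps_expn G k.+1 n.+1)); first exact: mulrCA.
by rewrite eG /deriv; ring.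
Qed.

(** The product telescopes, and the remaining power [n.+1] of [G] has no coefficient in degree
    [n]. *)
Lemma fps_comp_geometric a G : G 0 = 0 ->
  fps_mul (fps_comp (fun n => a ^+ n) G) (fps1 \- (a \*o G)) = fps1.
Proof.
move=> G0; apply: functional_extensionality => n; rewrite fps_mul_compl //.
pose term k := a ^+ k * fps_expn G k n.
transitivity (\sum_(k < n.+1) - (term k.+1 - term k)).
  apply: eq_bigr => k _.
  have -> : fps1 \- (a \*o G) = fps1 \+ (- a \*o G).
    by apply: functional_extensionality => m /=; rewrite mulNr.
  rewrite fps_mulDr fps_mulr1 fps_mulZr /= fps_mulC.
  by rewrite /term -[fps_mul G _]/(fps_expn G k.+1) exprS; ring.
rewrite sumrN -(big_mkord xpredT (fun k => term k.+1 - term k)).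
by rewrite telescope_sumr // opprB /term (@fps_expn_small _ G n.+1) // mulr0 subr0 expr0 mul1r.
Qed.

Lemma deriv_exp F : F 0 = 0 -> deriv (fps_exp F) = fps_mul (deriv F) (fps_exp F).
Proof.
move=> F0; rewrite /fps_exp deriv_comp // fps_mulC; congr (fps_mul _ (fps_comp _ _)).
apply: functional_extensionality => n; rewrite /deriv factS natrM invfM.
by rewrite mulVKf ?natS_neq0.
Qed.

(** The derivative of the logarithm series is geometric, so its value at [F \- fps1] is the inverse
    of [F]. *)
Lemma deriv_log F : F 0 = 1 -> fps_mul F (deriv (fps_log F)) = deriv F.
Proof.
move=> F1; have F0 : (F \- fps1) 0 = 0 by rewrite /= F1 subrr.
rewrite /fps_log deriv_comp //.
have -> : deriv (fun n => if n is m.+1 then (- 1) ^+ m / n%:R else 0) =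
    (fun n => (- 1) ^+ n) :> fps K.
  by apply: functional_extensionality => n; rewrite /deriv mulrC divfK ?natS_neq0.
have F_inv : fps_mul F (fps_comp (fun n => (- 1) ^+ n) (F \- fps1)) = fps1.
  rewrite fps_mulC -[RHS](fps_comp_geometric (- 1) F0); congr (fps_mul _ _).
  by apply: functional_extensionality => n /=; ring.
rewrite fps_mulA F_inv fps_mul1.
by apply: functional_extensionality => n; rewrite /deriv /= /fps1 /= subr0.
Qed.

Lemma fps_expn_cX c k n : fps_expn (c \*o fpsX) k n = c ^+ k * (n == k)%:R.
Proof.
elim: k n => [|k IHk] n; first by rewrite /fps_expn /= /fps1 mul1r.
rewrite /fps_expn iterS -/(fps_expn _ k) fps_mulZl /=.
case: n => [|n]; first by rewrite fps_mul_0 /fpsX mul0r !mulr0.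
rewrite /fps_mul big_ord_recl big_ord_recl big1 /=; last first.
  by move=> i _; rewrite /fpsX mul0r.
by rewrite /fpsX !mul0r mul1r add0r addr0 IHk /bump /= subSS subn0 eqSS exprS mulrA.
Qed.

Lemma fps_comp_cX c F : fps_comp F (c \*o fpsX) = scale_var c F.
Proof.
apply: functional_extensionality => n; rewrite /fps_comp big_ord_recr /= big1 ?add0r.
  by rewrite fps_expn_cX eqxx mulr1 mulrC.
by move=> i _; rewrite fps_expn_cX gtn_eqF ?mulr0.
Qed.

Lemma fps_int_cX c F : fps_int F (c \*o fpsX) = scale_var c (fps_prim F).
Proof. exact: fps_comp_cX. Qed.

(** * The cosine and the powers of the secant *)

Lemma deriv2_cos : deriv (deriv fps_cos) = - 1 \*o fps_cos.
Proof.
apply: functional_extensionality => n; rewrite /deriv /fps_cos /= negbK.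
case: odd; first by rewrite !mulr0.
have fact_neq0 : (n`!)%:R != 0 :> K.
  by move/pcharf0P: charK => ->; rewrite -lt0n fact_gt0.
rewrite exprS !factS !natrM; move: (natS_neq0 n) (natS_neq0 n.+1) fact_neq0.
move: n.+1%:R n.+2%:R n`!%:R => x y z x0 y0 z0.
by field; rewrite x0 y0 z0.
Qed.

Lemma deriv2_inj F G c : F 0 = G 0 -> F 1%N = G 1%N ->
  deriv (deriv F) = c \*o F -> deriv (deriv G) = c \*o G -> F = G.
Proof.
move=> FG0 FG1 dF dG; apply: functional_extensionality => n.
suff [] : F n = G n /\ F n.+1 = G n.+1 by [].
elim: n => // n [IH0 IH1]; split=> //.
apply: (mulfI (natS_neq0 n.+1)); apply: (mulfI (natS_neq0 n)).
have := congr1 (fun L => L n) dF; have := congr1 (fun L => L n) dG.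
by rewrite /deriv /= => -> ->; rewrite IH0.
Qed.

(* The unknown T plays the role of the tangent and E b that of sec^b. *)
Section SecantPowers.

Variables (T : fps K) (E : K -> fps K).
Hypotheses (T0 : T 0 = 0) (dT : deriv T = fps1 \+ fps_mul T T).
Hypotheses (E0 : forall b, E b 0 = 1)
           (dE : forall b, deriv (E b) = b \*o fps_mul T (E b)).

Lemma sec_ode_unique b F : F 0 = 1 -> deriv F = b \*o fps_mul T F -> F = E b.
Proof.
move=> F0 dF; apply: (@linear_ode_unique (b \*o T) (0 \*o fps1)).
- by rewrite F0 E0.
- by apply: functional_extensionality => n; rewrite dF fps_mulZl /= mul0r add0r.
by apply: functional_extensionality => n; rewrite dE fps_mulZl /= mul0r add0r.
Qed.

(** By the Leibniz rule the product solves the equation with exponent [a + b]. *)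
Lemma sec_powD a b : fps_mul (E a) (E b) = E (a + b).
Proof.
apply: sec_ode_unique; first by rewrite fps_mul_0 !E0 mulr1.
rewrite derivM !dE fps_mulZl fps_mulZr [in X in _ \+ X]fps_mulA.
rewrite [fps_mul (E a) T]fps_mulC -!fps_mulA.
by apply: functional_extensionality => n /=; rewrite mulrDl.
Qed.

Lemma sec_pow0 : E 0 = fps1.
Proof.
by symmetry; apply: sec_ode_unique; rewrite // deriv_fps1;
  apply: functional_extensionality => n /=; rewrite !mul0r.
Qed.

(** With F = E(-1), F' = -TF and T' = 1 + T^2 give F'' = -(1 + T^2)F + T^2 F = -F. *)
Lemma sec_powN1 : E (- 1) = fps_cos.
Proof.
apply: (@deriv2_inj _ _ (- 1)); last exact: deriv2_cos.
- by rewrite E0 /fps_cos /= fact0 divr1.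
- have /(congr1 (fun L => L 0%N)) := dE (- 1).
  by rewrite /deriv /= fps_mul_0 T0 mul0r mulr0 mul1r => ->.
rewrite dE derivZ derivM dT dE fps_mulDl fps_mul1 fps_mulZr !fps_mulA.
by apply: functional_extensionality => n /=; ring.
Qed.

Lemma sec_pow1 : E 1 = fps_sec.
Proof.
apply: (@fps_mul_lreg fps_cos).
  by rewrite -sec_powN1 E0.
rewrite -{1}sec_powN1 sec_powD addNr sec_pow0.
by apply: functional_extensionality => n; rewrite fps_mul_cos_sec.
Qed.

(** The logarithmic derivative of E_1(ct) is c T(ct), so both sides solve F' = b c T(ct) F with
    constant term 1. *)
Lemma sec_powE c b : sec_pow c b = scale_var c (E b).
Proof.
rewrite /sec_pow fps_comp_cX -sec_pow1.
set u := scale_var c (E 1).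
have u0 : u 0 = 1 by rewrite /u /scale_var expr0 mul1r E0.
have dlog : deriv (fps_log u) = c \*o scale_var c T.
  apply: (fps_mul_lreg u0); rewrite deriv_log // /u deriv_scale dE fps_mulZr.
  rewrite -scale_mul fps_mulC.
  by apply: functional_extensionality => n; rewrite /= /scale_var /= mul1r.
have L0 : (b \*o fps_log u) 0 = 0 by rewrite /= /fps_log fps_comp_0 mulr0.
apply: (@linear_ode_unique (b * c \*o scale_var c T) (0 \*o fps1)).
- by rewrite /fps_pow /fps_exp fps_comp_0 fact0 invr1 /scale_var expr0 mul1r E0.
- rewrite /fps_pow deriv_exp // derivZ dlog !fps_mulZl.
  by apply: functional_extensionality => n /=; ring.
rewrite deriv_scale dE fps_mulZl -scale_mul.
by apply: functional_extensionality => n; rewrite /= /scale_var /=; ring.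
Qed.

End SecantPowers.

End PowerSeries.

Section ScaleVar.

Variable K : fieldType.
Implicit Types (F : fps K) (a b c : K).

Lemma scale_varA a b F : scale_var a (scale_var b F) = scale_var (a * b) F.
Proof.
by apply: functional_extensionality => n; rewrite /scale_var exprMn mulrA.
Qed.

Lemma scale_var1 F : scale_var 1 F = F.
Proof. by apply: functional_extensionality => n; rewrite /scale_var expr1n mul1r. Qed.

Lemma scale_var_prim c F :
  scale_var c (fps_prim F) = c \*o fps_prim (scale_var c F).
Proof.
apply: functional_extensionality => -[|n]; rewrite /scale_var /= ?mulr0 //.
by rewrite exprS; ring.
Qed.

End ScaleVar.

(** * Differential equations of the alternating series *)

Section AlternatingSeries.

Variable K : fieldType.
Hypothesis charK : [pchar K] =i pred0.
Implicit Types (p q x : K) (b c : bool).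

(** Common form of the four series, up to the constant 1: [b] fixes the first step, [c] the parity
    of the length. *)
Definition alt_gf b c p q : fps K :=
  fun m => if (0 < m)%N && (odd m == c) then max_egf b p q m else 0.

Lemma max_gf_up_down c p q : max_gf up_down c p q = alt_gf false c p q.
Proof.
apply: functional_extensionality => m; rewrite /max_gf /alt_gf; case: ifP => // _.
congr (_ / _); rewrite big_mkcond; apply: eq_bigr => s _.
by rewrite up_downE /max_weight; case: alternating; rewrite ?mul1r ?mul0r.
Qed.

Lemma max_gf_down_up c p q : max_gf down_up c p q = alt_gf true c p q.
Proof.
apply: functional_extensionality => m; rewrite /max_gf /alt_gf; case: ifP => // _.
congr (_ / _); rewrite big_mkcond; apply: eq_bigr => s _.
by rewrite down_upE /max_weight; case: alternating; rewrite ?mul1r ?mul0r.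
Qed.

(* Left-to-right maxima of the alternating words ending with a descent, split
   by the parity of the length. *)
Definition left_gf b x : fps K :=
  fun m => if odd m == b then max_egf (~~ odd m) x 1 m else 0.

(** In even length the first and last steps have the same direction; [fps1] is the empty word. *)
Lemma left_gf_even x : left_gf false x = fps1 \+ alt_gf true false x 1.
Proof.
apply: functional_extensionality => -[|m]; rewrite /left_gf /alt_gf /fps1 /=.
  by rewrite max_egf0 addr0.
by rewrite add0r; case: odd.
Qed.

Lemma left_gf_odd x : left_gf true x = alt_gf false true x 1.
Proof.
apply: functional_extensionality => -[|m]; rewrite /left_gf /alt_gf //=.
by case: odd.
Qed.

(** A peak at position [k] forces [odd k = ~~ b], which leaves a right factor of parity [c (+) b].
    The word of length 1 is missed by the product exactly when [b] is false, whence the extra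
    term. *)
Lemma deriv_alt_gf b c p q :
  deriv (alt_gf b c p q) =
  ((~~ b && c)%:R * (p * q) \*o fps1) \+
  (p * q \*o fps_mul (left_gf (~~ b) p) (left_gf (c (+) b) q)).
Proof.
apply: functional_extensionality => n; rewrite /deriv /alt_gf /=.
have [cE | cN] := eqVneq (~~ odd n) c; last first.
  rewrite mulr0 (_ : _ * fps1 n = 0) ?add0r; last first.
    by case: n cN => [|n]; rewrite /fps1 ?mulr0 //=; case: c => // _; rewrite andbF !mul0r.
  (* In a degree of the wrong parity, no product of the two series has a term. *)
  rewrite /fps_mul big1 ?mulr0 // => i _; rewrite /left_gf oddB -1?ltnS //.
  by move: cN; case: (odd n); case: (odd i); case: b; case: c; rewrite ?mulr0 ?mul0r.
rewrite max_egf_rec // -{}cE; case: n => [|n].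
  rewrite big_ord1 fps_mul_0 /left_gf /fps1 /= !max_egf0 andbT.
  by case: b => /=; ring.
rewrite /fps1 mulr0 add0r; congr (_ * _); apply: eq_bigr => i _.
(* The right factor starts with an ascent, so its reversal ends with a descent. *)
rewrite /left_gf max_egf_rev oddB -1?ltnS //= negbK.
by case: (odd n); case: (odd i); case: b; rewrite /= ?mul1r ?mul0r ?mulr0.
Qed.

Lemma left_gf0 x : left_gf false x 0 = 1.
Proof. exact: max_egf0. Qed.

Lemma deriv_left_even x :
  deriv (left_gf false x) = x \*o fps_mul (left_gf true 1) (left_gf false x).
Proof.
rewrite left_gf_even derivD deriv_fps1 deriv_alt_gf -left_gf_even fps_mulC.
by apply: functional_extensionality => n /=; ring.
Qed.

Lemma deriv_left_odd x :
  deriv (left_gf true x) = x \*o (fps1 \+ fps_mul (left_gf true 1) (left_gf true x)).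
Proof.
rewrite left_gf_odd deriv_alt_gf -left_gf_odd fps_mulC.
by apply: functional_extensionality => n /=; ring.
Qed.

(** The Riccati equation of the tangent, which makes [left_gf true 1] the [T] of the secant
    powers. *)
Lemma deriv_tan :
  deriv (left_gf true 1) = fps1 \+ fps_mul (left_gf true (1 : K)) (left_gf true 1).
Proof.
by rewrite deriv_left_odd; apply: functional_extensionality => n /=; rewrite mul1r.
Qed.

Lemma left_evenD x y :
  fps_mul (left_gf false x) (left_gf false y) = left_gf false (x + y : K).
Proof. exact: (sec_powD charK left_gf0 deriv_left_even). Qed.

Lemma sec_pow_left (c x : K) : sec_pow c x = scale_var c (left_gf false x).
Proof.
exact: (sec_powE charK (T := left_gf true 1) (erefl _) deriv_tan left_gf0
  deriv_left_even).
Qed.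

(** Variation of constants: the homogeneous solution is E_x, with inverse E_(-x). *)
Lemma left_odd_prim x :
  left_gf true x = x \*o fps_mul (left_gf false x) (fps_prim (left_gf false (- x))).
Proof.
apply: (linear_ode_unique charK (A := x \*o left_gf true 1) (B := x \*o fps1)).
- by rewrite /= fps_mul_0 /= mulr0 mulr0.
- by rewrite deriv_left_odd fps_mulZl; apply: functional_extensionality => n /=; ring.
rewrite derivZ derivM deriv_prim // deriv_left_even left_evenD addrN.
rewrite (sec_pow0 charK left_gf0 deriv_left_even) !fps_mulZl fps_mulZr -fps_mulA.
by apply: functional_extensionality => n /=; ring.
Qed.

(** * The substitution s = pqt in the integrals *)

Lemma deriv_int_cX (c : K) F :
  deriv (fps_int F (c \*o fpsX)) = c \*o scale_var c F :> fps K.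
Proof. by rewrite fps_int_cX deriv_scale deriv_prim. Qed.

Lemma scale_sec_pow (c x : K) : c != 0 -> scale_var c (sec_pow c^-1 x) = left_gf false x.
Proof. by move=> c0; rewrite sec_pow_left scale_varA divff // scale_var1. Qed.

(** At s = cdt the upper bound s/d is ct, and z = cw turns the inner integral into c times that of
    sec(w)^x from 0 to t. *)
Lemma scale_int_sec_pow (c d x : K) : c != 0 -> d != 0 ->
  scale_var (c * d) (fps_int (sec_pow c^-1 x) (d^-1 \*o fpsX)) =
  c \*o fps_prim (left_gf false x).
Proof.
move=> c0 d0; rewrite fps_int_cX scale_varA mulfK // scale_var_prim.
by rewrite scale_sec_pow.
Qed.

End AlternatingSeries.

(** Each identity is checked on constant terms and derivatives. For [K] the field of rational
    functions in two variables over the rationals, [p] and [q] can be the indeterminates. *)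
Theorem theorem3 (K : fieldType) (charK : [pchar K] =i pred0)
    (p q : K) (p_neq0 : p != 0) (q_neq0 : q != 0) :
  [/\ G1 p q =1 fps1 \+
        fps_int (fps_mul (sec_pow (p * q)^-1 (p + q))
                         (fps_int (sec_pow p^-1 (- p)) (q^-1 \*o fpsX)))
                ((p * q) \*o fpsX),
      G2 p q =1 ((p * q) \*o fpsX) \+
        fps_int (fps_mul (fps_mul (sec_pow (p * q)^-1 (p + q))
                                  (fps_int (sec_pow p^-1 (- p)) (q^-1 \*o fpsX)))
                         (fps_int (sec_pow q^-1 (- q)) (p^-1 \*o fpsX)))
                ((p * q) \*o fpsX),
      G3 p q =1 fps1 \+
        fps_int (fps_mul (sec_pow (p * q)^-1 (p + q))
                         (fps_int (sec_pow q^-1 (- q)) (p^-1 \*o fpsX)))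
                ((p * q) \*o fpsX)
    & G4 p q =1 fps_int (sec_pow (p * q)^-1 (p + q)) ((p * q) \*o fpsX)].
Proof.
have pq0 : p * q != 0 by rewrite mulf_neq0.
have int0 F : fps_int F ((p * q) \*o fpsX) 0 = 0 :> K by apply: fps_comp_0.
have intP := scale_int_sec_pow charK (- p) p_neq0 q_neq0.
have intQ := scale_int_sec_pow charK (- q) q_neq0 p_neq0.
rewrite (mulrC q) in intQ.
split=> n.
- rewrite /G1 max_gf_up_down /=; congr (_ + _).
  congr (_ n); apply: (deriv_inj charK); first by rewrite int0.
  rewrite deriv_alt_gf // deriv_int_cX // !scale_mul scale_sec_pow // intP.
  (* The derivative on the left is pq O_p E_q; expanding O_p produces the same factor [p] as the
     rescaled inner integral. *)
  rewrite left_odd_prim // -left_evenD // !fps_mulZl !fps_mulZr fps_mulAC.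
  by apply: functional_extensionality => m /=; ring.
- rewrite /G2 max_gf_up_down; congr (_ n); apply: (deriv_inj charK).
    by rewrite /= int0 addr0 /fpsX mulr0.
  rewrite deriv_alt_gf // derivD deriv_int_cX // !scale_mul scale_sec_pow // intP intQ.
  rewrite !left_odd_prim // -left_evenD // !fps_mulZl !fps_mulZr !fps_mulZl.
  rewrite fps_mulA [fps_mul (fps_mul (left_gf _ p) _) (left_gf _ q)]fps_mulAC derivZ.
  (* The derivative of the term pqt accounts for the permutation of length 1. *)
  have -> : deriv fpsX = fps1 :> fps K.
    by apply: functional_extensionality => -[|m]; rewrite /deriv /fpsX /fps1 ?mulr1 ?mulr0.
  by apply: functional_extensionality => m /=; ring.
- rewrite /G3 max_gf_down_up /=; congr (_ + _).
  congr (_ n); apply: (deriv_inj charK); first by rewrite int0.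
  rewrite deriv_alt_gf // deriv_int_cX // !scale_mul scale_sec_pow // intQ.
  rewrite left_odd_prim // -left_evenD // !fps_mulZr fps_mulA.
  by apply: functional_extensionality => m /=; ring.
rewrite /G4 max_gf_down_up; congr (_ n); apply: (deriv_inj charK).
  by rewrite int0.
(* Both factors have even length here, so no inner integral arises. *)
rewrite deriv_alt_gf // deriv_int_cX // scale_sec_pow // left_evenD //.
by apply: functional_extensionality => m /=; ring.
Qed.
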